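(* Let $I=[\lambda_0,\lambda_1]\subset (\tfrac12,\,0.668)$. Then there exists a constant $C_1>0$ (depending on $I$) such that $$\text{for all } N\ge 1 \text{ and all } s>0:\qquad \int_I R_2(s,\lambda,2^N)\,d\lambda \le C_1 s .$$
   Context: For $\lambda\in(0,1)$ and $N\ge1$, let $\Omega_N=\{0,1\}^N$ and for $\omega=\omega_0\ldots\omega_{N-1}\in\Omega_N$ put $\pi^N_\lambda(\omega)=(1-\lambda)\sum_{n=0}^{N-1}\omega_n\lambda^n$. The finite Bernoulli convolution set is $A_N(\lambda)=\{\pi^N_\lambda(\omega):\omega\in\Omega_N\}$, taken with multiplicity, so it always consists of $2^N$ points (one for each $\omega\in\Omega_N$). The pair correlation function is $$R_2(s,\lambda,2^N)=\frac{1}{2^N}\,\#\Bigl\{(\omega,\tau)\in\Omega_N\times\Omega_N:\ \omega\ne\tau,\ |\pi^N_\lambda(\omega)-\pi^N_\lambda(\tau)|\le \frac{s}{2^N}\Bigr\},$$ i.e. the number of ordered pairs of distinct points of $A_N(\lambda)$ (counted with multiplicity) at distance at most $s2^{-N}$, divided by $2^N$. *)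

(* Defs.v *)
From HB Require Import structures.
From mathcomp Require Import all_boot all_order all_algebra.
From mathcomp Require Import all_classical all_reals all_analysis.

Set Implicit Arguments.
Unset Strict Implicit.
Unset Printing Implicit Defensive.

Import Order.TTheory GRing.Theory Num.Theory.
Import numFieldNormedType.Exports.

Local Open Scope ring_scope.

(* Binary words of length N; a letter is read as a number through
   bool >-> nat. *)
Definition Omega (N : nat) := {ffun 'I_N -> bool}.

Definition bernoulli_point (R : realType) (N : nat) (lambda : R)
    (w : Omega N) : R :=
  (1 - lambda) * \sum_(n < N) (w n)%:R * lambda ^+ n.

(* R_2(s, lambda, 2^N): the argument here is the word length N, not the number
   of points 2^N.  Pairs of distinct words are counted, so coinciding points
   coming from different words do contribute. *)
Definition pair_correlation (R : realType) (s lambda : R) (N : nat) : R :=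
  (2 ^+ N)^-1 *
  #|[pred p : Omega N * Omega N | (p.1 != p.2) &&
      (`|bernoulli_point lambda p.1 - bernoulli_point lambda p.2|
         <= s / 2 ^+ N)]|%:R.

(* Main.v *)
(* Two distinct words which first differ at letter k give points at distance
   (1 - x) x^k |g(x)|, where g = 1 + b_1 x + b_2 x^2 + ... has coefficients in
   {-1, 0, 1}.  Transversality: there is delta > 0 such that |g| <= delta forces
   |g'| > delta on [1/2, 668/1000], for every such g.  Hence {|g| <= rho} has
   measure O(rho), a pair of words with common prefix of length k contributes
   O(s 2^-N lambda0^-k) to the integral, and since about 4^N 2^-k pairs agree on
   k letters, the sum over k is a geometric series of ratio 1 / (2 lambda0) < 1.

   Smallest double zeros of such g are near 0.66848, so transversality up to
   0.668 needs a finite search.  At a rational point c, if g(c) and g'(c) are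
   both tiny then each tail h = b_n + b_{n+1} x + ... of g has (h(c), h'(c))
   close to a known point that depends only on the first n coefficients.  These
   points are driven outside the convex set of all values (h(c), h'(c)) after a
   few coefficients, for every choice of them.  As g and g' are uniformly
   Lipschitz, ten suitably chosen c suffice. *)
Require Import Defs.
From Stdlib Require Import ZArith.
From HB Require Import structures.
From mathcomp Require Import all_boot all_order all_algebra.
From mathcomp Require Import all_classical all_reals all_analysis.
From mathcomp Require Import measurable_realfun.
From mathcomp Require Import ssrZ zify ring lra.

Set Implicit Arguments.
Unset Strict Implicit.
Unset Printing Implicit Defensive.

Import Order.TTheory GRing.Theory Num.Theory.
Import numFieldNormedType.Exports.

Local Open Scope classical_set_scope.
Local Open Scope ring_scope.

(** * Integer certificate for transversality *)

Section Certificate.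
Variables P Q : Z.

(* With c = P / Q this is Q^n times a bound on |a h(c) + b h'(c)| over all h
   with digits in {-1, 0, 1}: the first n digits are maximized exactly, the
   others through 1 / (1 - c) <= 4 and 1 / (1 - c)^2 <= 10. *)
Fixpoint support_bound (n : nat) (a b : Z) : Z :=
  if n is n'.+1 then
    `|a| * Q ^+ n + support_bound n' (a * P + b * Q) (b * P)
  else 4 * `|a| + 10 * `|b|.

(** Normals to supporting lines of the set of values (h(c), h'(c)). That set is symmetric under h ->
    -h, so each normal also serves for its opposite. *)
Definition directions : seq (Z * Z) :=
  [:: (1, 0); (0, 1); (-3, 1); (-6, 1)].

(** Rounding up to a multiple of 2^-10 keeps the table entries small; 12 digits are maximized
    exactly. *)
Definition support_ceil (d : Z * Z) : Z :=
  Z.div (2 ^+ 10 * support_bound 12 d.1 d.2)%R (Q ^+ 12)%R + 1.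

Definition support_table : seq (Z * Z * Z) :=
  [seq (d, support_ceil d) | d <- directions].

(* The box |D h(c) - A| <= E, |D h'(c) - B| <= G is on the wrong side of a
   supporting line with normal direction d. *)
Definition separates (A B E G D : Z) (dt : Z * Z * Z) : bool :=
  let: (d, t) := dt in
  t * D + 2 ^+ 10 * (`|d.1| * E + `|d.2| * G)
    < 2 ^+ 10 * `|d.1 * A + d.2 * B|.

Variable table : seq (Z * Z * Z).

(* No h with digits in {-1, 0, 1} has its values in the box.  The recursive call
   is the box of h1 when h = b + x h1.  A conditional replaces [||], since
   [vm_compute] would evaluate both disjuncts. *)
Fixpoint tail_excluded (fuel : nat) (A B E G D : Z) : bool :=
  if has (separates A B E G D) table then true else
  if fuel is fuel'.+1 then
    all (fun b : Z =>
      tail_excluded fuel' ((A - b * D) * Q * P)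
        ((B * P - (A - b * D) * Q) * Q)
        (E * Q * P) ((G * P + E * Q) * Q) (D * P ^+ 2))
      [:: 1; 0; -1]
  else false.

Lemma support_bound0 a b : support_bound 0 a b = 4 * `|a| + 10 * `|b|.
Proof. by []. Qed.

Lemma support_boundS n a b : support_bound n.+1 a b =
  `|a| * Q ^+ n.+1 + support_bound n (a * P + b * Q) (b * P).
Proof. by []. Qed.

Lemma tail_excluded0 A B E G D :
  tail_excluded 0 A B E G D = has (separates A B E G D) table.
Proof. by rewrite /=; case: ifP. Qed.

Lemma tail_excludedS fuel A B E G D : tail_excluded fuel.+1 A B E G D =
  has (separates A B E G D) table ||
  all (fun b : Z =>
      tail_excluded fuel ((A - b * D) * Q * P)
        ((B * P - (A - b * D) * Q) * Q)
        (E * Q * P) ((G * P + E * Q) * Q) (D * P ^+ 2))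
    [:: 1; 0; -1].
Proof. by []. Qed.

End Certificate.

(* If |g| and |g'| are at most 1 / Q^2 somewhere in [(P - m) / Q, (P + m) / Q]
   then Q^2 |g(c)| <= E and Q^2 |g'(c)| <= G, by Taylor's formula with
   |g''| <= 56.  The box tested is that of h when g = 1 + x h. *)
Definition piece_ok (Q P m : Z) : bool :=
  let D := Q ^+ 2 in
  let E := 28 * m ^+ 2 + 2 in
  let G := 56 * m * Q + 1 in
  [&& 0 < m, m <= P, 100 * (P + m) <= 67 * Q &
  tail_excluded P Q (support_table P Q) 20 (- D * Q * P)%R (D * Q * Q)%R
        (E * Q * P)%R ((G * P + E * Q) * Q)%R (D * P ^+ 2)%R].

Fixpoint covered (Q lo : Z) (ms : seq Z) (hi : Z) : bool :=
  if ms is m :: ms' then piece_ok Q (lo + m) m && covered Q (lo + 2 * m) ms' hi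
  else hi <= lo.

(* Greedy choice: each half-width is nearly the largest that passes the test. *)
Lemma certificate : exists Q lo hi ms,
  [/\ 0 < Q, Q = 2 * lo, 167 * Q < 250 * hi & covered Q lo ms hi].
Proof.
exists 20000, 10000, 13361, [:: 300; 300; 300; 300; 270; 127; 51; 22; 9; 3].
by split; vm_compute.
Qed.

(** The certificate is computed in binary integers; this morphism carries its inequalities to the
    field. *)
Definition realZ (R : pzRingType) (z : Z) : R := (int_of_Z z)%:~R.

HB.instance Definition _ (R : pzRingType) :=
  GRing.RMorphism.copy (@realZ R) (intr \o int_of_Z).

(** * Bounds for digit series and their derivatives *)

Section DigitSeries.
Variable R : realFieldType.
Implicit Types (h : seq R) (x y c : R).

Fixpoint ev h x : R := if h is b :: h' then b + x * ev h' x else 0.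

(** Derivative of [ev h], by the product rule at each Horner step. *)
Fixpoint dev h x : R := if h is _ :: h' then ev h' x + x * dev h' x else 0.

Definition digits h := all (mem [:: 1; 0; -1]) h.

Lemma digit_norm (b : R) : b \in [:: 1; 0; -1] -> `|b| <= 1.
Proof.
by rewrite !inE => /or3P[] /eqP->; rewrite ?normrN ?normr1 ?normr0.
Qed.

(* In the bounds below 100 / 33 is 1 / (1 - 67 / 100). *)
Lemma ler_normM67 x (a b : R) : 0 <= x <= 67 / 100 -> `|a| <= b ->
  `|x| * `|a| <= 67 / 100 * b.
Proof.
move=> /andP[x0 xM] ab; rewrite ger0_norm //.
by apply: ler_pM => //; apply: normr_ge0.
Qed.

Lemma ev_bound h x : digits h -> 0 <= x <= 67 / 100 ->
  `|ev h x| <= 100 / 33.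
Proof.
move=> + xM; elim: h => [|b h IH] /=; first by rewrite normr0; lra.
move=> /andP[/digit_norm b1 /IH hb]; apply: le_trans (ler_normD _ _) _.
rewrite normrM; have := ler_normM67 xM hb; lra.
Qed.

Lemma dev_bound h x : digits h -> 0 <= x <= 67 / 100 ->
  `|dev h x| <= (100 / 33) ^+ 2.
Proof.
move=> + xM; elim: h => [|b h IH] /=; first by rewrite normr0; lra.
move=> /andP[_ dh]; apply: le_trans (ler_normD _ _) _.
by rewrite normrM; have := ler_normM67 xM (IH dh); have := ev_bound dh xM; lra.
Qed.

Lemma ev_lipschitz h x y : digits h ->
  0 <= x <= 67 / 100 -> 0 <= y <= 67 / 100 ->
  `|ev h x - ev h y| <= (100 / 33) ^+ 2 * `|x - y|.
Proof.
move=> + xM yM; elim: h => [|b h IH] /=.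
  by rewrite subrr normr0; have := normr_ge0 (x - y); lra.
move=> /andP[_ dh].
have -> : b + x * ev h x - (b + y * ev h y) =
  (x - y) * ev h x + y * (ev h x - ev h y) by ring.
apply: le_trans (ler_normD _ _) _; rewrite !normrM.
have := ler_wpM2l (normr_ge0 (x - y)) (ev_bound dh xM).
have := ler_normM67 yM (IH dh); have := normr_ge0 (x - y); lra.
Qed.

(** The constant is the bound 2 / (1 - x)^3 on |g''|, taken at x = 67 / 100. *)
Lemma dev_lipschitz h x y : digits h ->
  0 <= x <= 67 / 100 -> 0 <= y <= 67 / 100 ->
  `|dev h x - dev h y| <= 2 * (100 / 33) ^+ 3 * `|x - y|.
Proof.
move=> + xM yM; elim: h => [|b h IH] /=.
  by rewrite subrr normr0; have := normr_ge0 (x - y); lra.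
move=> /andP[_ dh].
have -> : ev h x + x * dev h x - (ev h y + y * dev h y) =
  (ev h x - ev h y) + (x - y) * dev h x + y * (dev h x - dev h y) by ring.
apply: le_trans (ler_normD _ _) _.
apply: le_trans (lerD (ler_normD _ _) (lexx _)) _; rewrite !normrM.
have := ler_wpM2l (normr_ge0 (x - y)) (dev_bound dh xM).
have := ler_normM67 yM (IH dh); have := ev_lipschitz dh xM yM.
have := normr_ge0 (x - y); lra.
Qed.

(** Prepending a digit multiplies the remainder by y and adds (y - x)^2 [dev h x]; the constant M
    solves M = 67/100 M + (100/33)^2. *)
Lemma ev_taylor h x y : digits h ->
  0 <= x <= 67 / 100 -> 0 <= y <= 67 / 100 ->
  `|ev h y - ev h x - (y - x) * dev h x|
    <= (100 / 33) ^+ 3 * (y - x) ^+ 2.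
Proof.
move=> + xM yM; have s0 := sqr_ge0 (y - x).
elim: h => [|b h IH] /=.
  by rewrite !(subr0, mulr0) normr0; lra.
move=> /andP[_ dh].
have -> : b + y * ev h y - (b + x * ev h x) -
    (y - x) * (ev h x + x * dev h x) =
  y * (ev h y - ev h x - (y - x) * dev h x) + (y - x) ^+ 2 * dev h x by ring.
apply: le_trans (ler_normD _ _) _.
rewrite normrM [X in _ + X <= _]normrM (ger0_norm s0).
have := ler_wpM2l s0 (dev_bound dh xM).
have := ler_normM67 yM (IH dh); lra.
Qed.




(** * Order properties of the embedding of the integers *)

Local Notation Zr := (@realZ R).

Lemma Zr_ge0 z : 0 <= z -> 0 <= Zr z.
Proof.
move=> z0; have -> : z = (Z.to_nat z)%:R.
  by rewrite -[LHS]Z2Nat.id ?[LHS]Z_of_nat_natmul; lia.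
by rewrite rmorph_nat.
Qed.

Lemma Zr_gt0 z : 0 < z -> 0 < Zr z.
Proof.
move=> z0; have /Zr_ge0 : 0 <= z - 1 by lia.
rewrite rmorphB rmorph1; lra.
Qed.

Lemma Zr_lt a b : a < b -> Zr a < Zr b.
Proof. by rewrite -subr_gt0 => /Zr_gt0; rewrite rmorphB subr_gt0. Qed.

Lemma Zr_le a b : a <= b -> Zr a <= Zr b.
Proof. by rewrite -subr_ge0 => /Zr_ge0; rewrite rmorphB subr_ge0. Qed.

Lemma Zr_norm a : Zr `|a| = `|Zr a|.
Proof.
case: (lerP 0 a) => a0; first by rewrite !ger0_norm ?Zr_ge0.
rewrite !ltr0_norm ?rmorphN //; have := Zr_lt a0; by rewrite rmorph0.
Qed.

Lemma ZrD a b : Zr (a + b) = Zr a + Zr b. Proof. exact: rmorphD. Qed.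
Lemma ZrN a : Zr (- a) = - Zr a. Proof. exact: rmorphN. Qed.
Lemma ZrM a b : Zr (a * b) = Zr a * Zr b. Proof. exact: rmorphM. Qed.
Lemma ZrX a n : Zr (a ^+ n) = Zr a ^+ n. Proof. exact: rmorphXn. Qed.
Lemma Zr_nat n : Zr n%:R = n%:R. Proof. exact: rmorph_nat. Qed.
Definition ZrE := (ZrD, ZrN, ZrM, ZrX, Zr_nat, Zr_norm).

(** * Soundness of the box search *)

Section Soundness.
Variables (P Q : Z).
Hypothesis (Q0 : 0 < Q).
Let p := Zr P.
Let q := Zr Q.
Let c := p / q.
Hypothesis (cM : 0 <= c <= 67 / 100).

Lemma support_bound_sound n a b h : digits h ->
  `|Zr a * ev h c + Zr b * dev h c| * q ^+ n <= Zr (support_bound P Q n a b).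
Proof.
have q0 : 0 < q := Zr_gt0 Q0; have cq : c * q = p by rewrite /c divfK ?gt_eqF.
elim: n a b h => [|n IH] a b h dh.
  rewrite support_bound0 expr0 mulr1 !ZrE.
  apply: le_trans (ler_normD _ _) _; rewrite !normrM.
  have := ler_wpM2l (normr_ge0 (Zr a)) (ev_bound dh cM).
  have := ler_wpM2l (normr_ge0 (Zr b)) (dev_bound dh cM).
  have := normr_ge0 (Zr a); have := normr_ge0 (Zr b); lra.
rewrite support_boundS; case: h dh => [|d h] /= dh.
  rewrite !mulr0 addr0 normr0 mul0r.
  rewrite !ZrE addr_ge0 //; first by rewrite mulr_ge0 // exprn_ge0 // ltW.
  (* At the empty sequence the induction hypothesis says that the remaining bound is nonnegative. *)
  by have := IH (a * P + b * Q) (b * P) [::] isT;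
    rewrite !mulr0 addr0 normr0 mul0r.
case/andP: dh => /digit_norm d1 dh.
rewrite ZrD ZrM ZrX Zr_norm -/q.
apply: le_trans (lerD (lexx _) (IH _ _ _ dh)).
rewrite !ZrE -/p -/q -cq.
have -> : (Zr a * (c * q) + Zr b * q) * ev h c + Zr b * (c * q) * dev h c =
  ((Zr a * c + Zr b) * ev h c + Zr b * c * dev h c) * q by ring.
rewrite normrM (ger0_norm (ltW q0)) -[X in _ <= _ + X]mulrA -exprS -mulrDl.
apply: ler_wpM2r; first by rewrite exprn_ge0 // ltW.
have -> : Zr a * (d + c * ev h c) + Zr b * (ev h c + c * dev h c) =
  Zr a * d + ((Zr a * c + Zr b) * ev h c + Zr b * c * dev h c) by ring.
apply: le_trans (ler_normD _ _) _; apply: lerD => //.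
by rewrite normrM -[leRHS]mulr1 ler_wpM2l.
Qed.

(** Box with centre (A/D, B/D) and half-widths E/D, G/D, denominators cleared. *)
Definition in_box (A B E G D : Z) h : Prop :=
  `|Zr D * ev h c - Zr A| <= Zr E /\ `|Zr D * dev h c - Zr B| <= Zr G.

Lemma support_table_sound a b t h : (a, b, t) \in support_table P Q ->
  digits h -> 2 ^+ 10 * `|Zr a * ev h c + Zr b * dev h c| <= Zr t.
Proof.
move=> /mapP[d _ Ed] dh.
have -> : t = support_ceil P Q (a, b).
  rewrite (congr1 fst Ed : (a, b) = d).
  exact: (congr1 snd Ed : t = support_ceil P Q d).
rewrite /support_ceil /fst /snd.
have q0 : 0 < q ^+ 12 by rewrite exprn_gt0 // Zr_gt0.
have Q12 : (0 < Q ^+ 12)%R by rewrite exprn_gt0.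
set u := (2 ^+ 10 * support_bound _ _ _ _ _)%R.
have /Zr_le : u <= Q ^+ 12 * (Z.div u (Q ^+ 12)%R + 1).
  apply/Z.leb_le/Z.lt_le_incl/Z.mul_succ_div_gt.
  exact/Z.ltb_lt.
rewrite ZrM ZrX -/q /u ZrM ZrX (Zr_nat 2) => le_t.
rewrite -(ler_pM2l q0); apply: le_trans le_t.
by rewrite mulrCA ler_pM2l ?exprn_gt0 // mulrC support_bound_sound.
Qed.

(** Inside the box, pairing with the normal moves by at most |a| E + |b| G from its value at the
    centre, which is too little to come below the support bound. *)
Lemma separates_sound A B E G D dt h : 0 < D -> digits h ->
  dt \in support_table P Q -> separates A B E G D dt -> ~ in_box A B E G D h.
Proof.
case: dt => [[a b] t] D0 dh /support_table_sound/(_ dh) sup.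
rewrite /separates /= => /Zr_lt sep [hE hG].
have r0 := Zr_gt0 D0; move: sep; rewrite !ZrE => sep.
have qn : 0 < 2 ^+ 10 :> R by rewrite exprn_gt0.
suff : `|Zr a * Zr A + Zr b * Zr B| <=
  `|Zr D * (Zr a * ev h c + Zr b * dev h c)|
    + (`|Zr a| * Zr E + `|Zr b| * Zr G).
  rewrite [X in _ <= X + _]normrM (gtr0_norm r0).
  move=> /(ler_wpM2l (ltW qn)); have := ler_wpM2r (ltW r0) sup; lra.
have -> : Zr a * Zr A + Zr b * Zr B =
  Zr D * (Zr a * ev h c + Zr b * dev h c)
  - (Zr a * (Zr D * ev h c - Zr A) + Zr b * (Zr D * dev h c - Zr B)) by ring.
apply: le_trans (ler_normB _ _) _; rewrite lerD2l.
apply: le_trans (ler_normD _ _) _; rewrite !normrM.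
by apply: lerD; apply: ler_wpM2l.
Qed.

(** If h = d + x h1 then h1(c) = (h(c) - d) / c and h1'(c) = (h'(c) - h1(c)) / c; the new
    denominator D P^2 clears both divisions. *)
Lemma in_box_behead A B E G D (d : Z) h : 0 <= P ->
  in_box A B E G D (Zr d :: h) ->
  in_box ((A - d * D) * Q * P)%R ((B * P - (A - d * D) * Q) * Q)%R
         (E * Q * P)%R ((G * P + E * Q) * Q)%R (D * P ^+ 2)%R h.
Proof.
move=> /Zr_ge0 p0 [/= hE hG]; have q0 : 0 < q := Zr_gt0 Q0.
have cq : p = c * q by rewrite /c divfK ?gt_eqF.
rewrite /in_box !ZrE -/p -/q.
rewrite -/p in p0; have qp : 0 <= q * p by rewrite mulr_ge0 // ltW.
split.
  have -> : Zr D * p ^+ 2 * ev h c - (Zr A - Zr d * Zr D) * q * p =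
    (Zr D * (Zr d + c * ev h c) - Zr A) * (q * p) by rewrite cq; ring.
  by rewrite normrM (ger0_norm qp) -[leRHS]mulrA ler_wpM2r.
have -> : Zr D * p ^+ 2 * dev h c - (Zr B * p - (Zr A - Zr d * Zr D) * q) * q =
  (Zr D * (ev h c + c * dev h c) - Zr B) * (q * p)
  - (Zr D * (Zr d + c * ev h c) - Zr A) * (q * q) by rewrite cq; ring.
apply: le_trans (ler_normB _ _) _.
have qq : 0 <= q * q by rewrite mulr_ge0 // ltW.
rewrite !normrM (ger0_norm (ltW q0)) (ger0_norm p0).
have := ler_wpM2r qp hG; have := ler_wpM2r qq hE; lra.
Qed.

(** Lets an exhausted sequence follow the branch of digit 0 in the search. *)
Lemma in_box_nil A B E G D :
  in_box A B E G D [::] -> in_box A B E G D [:: Zr 0].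
Proof. by rewrite /in_box /= rmorph0 !(mulr0, addr0). Qed.

Lemma tail_excluded_sound fuel A B E G D h : 0 < P -> 0 < D -> digits h ->
  tail_excluded P Q (support_table P Q) fuel A B E G D -> ~ in_box A B E G D h.
Proof.
move=> P0; elim: fuel A B E G D h => [|f IH] A B E G D h D0 dh.
  by rewrite tail_excluded0 => /hasP[d dT]; apply: separates_sound.
rewrite tail_excludedS => /orP[/hasP[d dT]|]; first exact: separates_sound.
have D'0 : 0 < D * P ^+ 2 by rewrite mulr_gt0 // exprn_gt0.
move=> /and4P[t1 t0 tN _].
have step (d : Z) h' : digits h' ->
    tail_excluded P Q (support_table P Q) f ((A - d * D) * Q * P)%R
      ((B * P - (A - d * D) * Q) * Q)%R
      (E * Q * P)%R ((G * P + E * Q) * Q)%R (D * P ^+ 2)%R ->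
    ~ in_box A B E G D (Zr d :: h').
  by move=> dh' t /(in_box_behead (ltW P0)); apply: IH t.
case: h dh => [_ /in_box_nil|b h /andP[+ dh]]; first exact: step.
rewrite /= !inE => /or3P[] /eqP->.
- by rewrite -(rmorph1 Zr); apply: step.
- by rewrite -(rmorph0 Zr); apply: step.
- by rewrite -(rmorphN1 Zr); apply: step.
Qed.

End Soundness.

(** * Transversality on [1/2, 668/1000] *)

Lemma piece_ok_sound (P Q m : Z) x h : 0 < Q -> piece_ok Q P m ->
  `|Zr P / Zr Q - x| <= Zr m / Zr Q -> digits h ->
  `|ev (1 :: h) x| <= (Zr Q ^+ 2)^-1 ->
  (Zr Q ^+ 2)^-1 < `|dev (1 :: h) x|.
Proof.
move=> Q0 /and4P[m0 mP PM ex] xP dh gx; rewrite ltNge; apply/negP => g'x.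
have q0 := Zr_gt0 Q0; have P0 : 0 < P by lia.
have p0 := Zr_gt0 P0; have r0 := Zr_gt0 m0.
have rp := Zr_le mP; have := Zr_le PM; rewrite !ZrE => pM.
set c := Zr P / Zr Q in xP *; set r := Zr m / Zr Q in xP.
have cM : 0 <= c <= 67 / 100.
  by rewrite /c ler_pdivlMr // ler_pdivrMr // mul0r ltW //=; lra.
have xM : 0 <= x <= 67 / 100.
  have c1 : r <= c by rewrite /c /r ler_pM2r ?invr_gt0.
  have c2 : c + r <= 67 / 100.
    by rewrite /c /r -mulrDl ler_pdivrMr //; lra.
  by move: xP; rewrite ler_norml; lra.
have dg : digits (1 :: h) by rewrite /= inE eqxx.
have r1 : r <= 1 by rewrite /r ler_pdivrMr // mul1r; lra.
have rq : r * Zr Q = Zr m by rewrite /r divfK ?gt_eqF.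
have rr0 : 0 < r by rewrite divr_gt0.
(* An opaque name makes Q^2 an atom for [lra]. *)
have [D DE] : exists D, D = Zr Q ^+ 2 by exists (Zr Q ^+ 2).
rewrite -DE in gx g'x.
have D0 : 0 < D by rewrite DE exprn_gt0.
have Dr : D * r ^+ 2 = Zr m ^+ 2 by rewrite DE -exprMn mulrC rq.
have Dr1 : D * r = Zr m * Zr Q by rewrite DE expr2 -mulrA [_ * r]mulrC rq mulrC.
have scale (u : R) : D * `|u| = `|D * u| by rewrite normrM (gtr0_norm D0).
have {}gx : D * `|ev (1 :: h) x| <= 1 by rewrite -ler_pdivlMl // mulr1.
have {}g'x : D * `|dev (1 :: h) x| <= 1 by rewrite -ler_pdivlMl // mulr1.
have box : in_box P Q 0 0 (28 * m ^+ 2 + 2)%R (56 * m * Q + 1)%R (Q ^+ 2)%R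
    (1 :: h).
  rewrite /in_box !ZrE -DE -/c (rmorph0 Zr) (rmorph1 Zr) !subr0 -!scale.
  have r2 : (c - x) ^+ 2 <= r ^+ 2.
    by move: xP rr0; rewrite ler_norml => /andP[? ?] ?; nra.
  split.
    (* Taylor at x gives D |g(c)| <= 28 D r^2 + 1 + r, where D r^2 = m^2 and r <= 1. *)
    move: (ev_taylor dg xM cM) gx g'x.
    set t := ev _ c; set u := ev _ x; set v := dev _ x => tay gx g'x.
    have tri : `|t| <= `|t - u - (c - x) * v| + `|u| + `|c - x| * `|v|.
      rewrite -normrM; apply: le_trans (lerD (ler_normD _ _) (lexx _)).
      by apply: le_trans (ler_normD _ _); rewrite le_eqVlt; apply/orP; left;
        apply/eqP; congr `|_|; ring.
    have := ler_wpM2l (ltW D0) tri.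
    have := ler_wpM2l (ltW D0) tay; have := ler_wpM2l (ltW D0) r2.
    have := ler_pM (normr_ge0 _) (mulr_ge0 (ltW D0) (normr_ge0 v)) xP g'x.
    have := sqr_ge0 (Zr m); lra.
  have := ler_wpM2l (ltW D0) (dev_lipschitz dg cM xM).
  have := ler_wpM2l (ltW D0) xP.
  have := ler_wpM2l (ltW D0) (ler_normD (dev (1 :: h) c - dev (1 :: h) x)
                                     (dev (1 :: h) x)).
  by rewrite subrK; have := mulr_gt0 r0 q0; lra.
have Q2 : 0 < Q ^+ 2 by rewrite exprn_gt0.
have := tail_excluded_sound Q0 cM P0 _ dh ex; apply.
  by rewrite mulr_gt0 // exprn_gt0.
(* Removing the leading 1 from the box centred at the origin yields the box tested by [piece_ok]. *)
rewrite -(rmorph1 Zr) in box.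
have := in_box_behead Q0 (ltW P0) box.
by congr in_box; ring.
Qed.

(** Consecutive pieces share an endpoint. The right end is excluded so that no x is left over when
    the list is empty and [hi <= lo]. *)
Lemma covered_sound (Q lo hi : Z) ms x : 0 < Q -> covered Q lo ms hi ->
  Zr lo / Zr Q <= x < Zr hi / Zr Q ->
  exists P m, piece_ok Q P m /\ `|Zr P / Zr Q - x| <= Zr m / Zr Q.
Proof.
move=> Q0; have q0 := Zr_gt0 Q0; elim: ms lo => [|m ms IH] lo.
  move=> /Zr_le hilo /andP[lox xhi]; have := le_lt_trans lox xhi.
  by rewrite ltr_pM2r ?invr_gt0 // ltNge hilo.
move=> /andP[ok cov] /andP[lox xhi].
have [x_le|x_gt] := leP x (Zr (lo + 2 * m) / Zr Q); last first.
  by apply: IH cov _; rewrite xhi ltW.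
exists (lo + m), m; split=> //; move: x_le lox; rewrite !ZrE !mulrDl ler_norml.
by rewrite -mulrA; lra.
Qed.

Lemma transversality : exists2 delta : R, 0 < delta & forall x h,
  1 / 2 <= x <= 668 / 1000 -> digits h ->
  `|ev (1 :: h) x| <= delta -> delta < `|dev (1 :: h) x|.
Proof.
have [Q [lo [hi [ms [Q0 /(congr1 Zr) Qlo /Zr_lt Qhi cov]]]]] := certificate.
rewrite (ZrM 2) (Zr_nat 2) in Qlo.
rewrite (ZrM 167) (ZrM 250) (Zr_nat 167) (Zr_nat 250) in Qhi.
have q0 := Zr_gt0 Q0.
(* All pieces have the same denominator Q, so one delta serves them all. *)
exists (Zr Q ^+ 2)^-1; first by rewrite invr_gt0 exprn_gt0.
move=> x h /andP[x0 x1] dh.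
have [|P [m [ok xP]]] := covered_sound Q0 cov (x := x).
  rewrite ler_pdivrMr // ltr_pdivlMr //.
  by have := ler_wpM2r (ltW q0) x0; have := ler_wpM2r (ltW q0) x1; lra.
exact: piece_ok_sound ok xP dh.
Qed.

(** * Sublevel sets of digit series *)

(** At distance at most delta / 56 the Taylor remainder, below 28 |x - y|^2, absorbs at most half of
    the linear term. *)
Lemma ev_separation (delta : R) x y h : digits h -> 0 < delta ->
  0 <= x <= 67 / 100 -> 0 <= y <= 67 / 100 ->
  delta < `|dev h x| -> `|x - y| <= delta / 56 ->
  delta / 2 * `|x - y| <= `|ev h x - ev h y|.
Proof.
move=> dh d0 xM yM dx xy; have tay := ev_taylor dh xM yM.
have : `|x - y| * `|dev h x| <=
    `|ev h y - ev h x - (y - x) * dev h x| + `|ev h x - ev h y|.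
  rewrite -normrM.
  have -> : (x - y) * dev h x =
    (ev h y - ev h x - (y - x) * dev h x) + (ev h x - ev h y) by ring.
  exact: ler_normD.
have sq : (y - x) ^+ 2 = `|x - y| * `|x - y|.
  by rewrite -normrM ger0_norm -expr2 ?sqr_ge0 // -sqrrN opprB.
rewrite sq in tay.
have n0 := normr_ge0 (x - y).
have := ler_wpM2l n0 xy; have := ler_wpM2l n0 (ltW dx).
have := mulr_ge0 n0 (ltW d0);
lra.
Qed.

Lemma sublevel_diameter (delta : R) :
  (forall x h, 1 / 2 <= x <= 668 / 1000 -> digits h ->
    `|ev (1 :: h) x| <= delta -> delta < `|dev (1 :: h) x|) -> 0 < delta ->
  forall rho x y h, digits h ->
  1 / 2 <= x <= 668 / 1000 -> 1 / 2 <= y <= 668 / 1000 ->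
  `|x - y| <= delta / 56 ->
  `|ev (1 :: h) x| <= rho -> `|ev (1 :: h) y| <= rho ->
  `|x - y| <= 4 / delta * rho.
Proof.
move=> trans d0 rho x y h dh xI yI xy gx gy.
rewrite mulrAC ler_pdivlMr //.
(* For rho > delta the bound exceeds 4, while the points are at distance at most 1. *)
have [rd|dr] := leP rho delta; last first.
  have : `|x - y| <= 1 by rewrite ler_norml; lra.
  by move/(ler_wpM2r (ltW d0)); lra.
have dg : digits (1 :: h) by rewrite /= inE eqxx.
have xM : 0 <= x <= 67 / 100 by lra.
have yM : 0 <= y <= 67 / 100 by lra.
have := ev_separation dg d0 xM yM (trans _ _ xI dh (le_trans gx rd)) xy.
by have := ler_normB (ev (1 :: h) x) (ev (1 :: h) y); lra.
Qed.

Lemma ev_sum h x : ev h x = \sum_(i < size h) h`_i * x ^+ i.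
Proof.
elim: h => [|b h IH] /=; first by rewrite big_ord0.
rewrite big_ord_recl /= mulr1 IH mulr_sumr; congr (_ + _).
by apply: eq_bigr => i _; rewrite /= exprS mulrCA.
Qed.

(** The leading zeros factor out as x^k; if the first nonzero digit is -1, all signs are flipped,
    which the absolute value ignores. *)
Lemma ev_first_nonzero h k : digits h -> h`_k != 0 ->
  (forall i, (i < k)%N -> h`_i = 0) ->
  exists2 h', digits h' & forall x, `|ev h x| = `|x| ^+ k * `|ev (1 :: h') x|.
Proof.
elim: k h => [|k IH] [|b h] dh.
- by rewrite eqxx.
- move: dh => /andP[bd dh] /= b0 _; move: bd b0; rewrite !inE => /or3P[] /eqP->.
  + by exists h => // x; rewrite mul1r.
  + by rewrite eqxx.
  + exists (map -%R h) => [|x].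
      rewrite /digits all_map; apply: sub_all dh => c; rewrite /= !inE.
      by move=> /or3P[] /eqP->; rewrite ?oppr0 ?opprK eqxx ?orbT.
    rewrite mul1r -normrN opprD opprK; congr `|1 + _|; rewrite -mulrN.
    congr (_ * _); elim: h {dh} => [|c h IH] /=; first by rewrite oppr0.
    by rewrite opprD -mulrN IH.
- by rewrite nth_nil eqxx.
- move: dh => /andP[_ dh] /= hk lo.
  have [|h' dh' E] := IH h dh hk; first by move=> i ik; apply: (lo i.+1).
  exists h' => // x; have /= -> := lo 0%N isT.
  by rewrite add0r normrM E exprS mulrA.
Qed.

End DigitSeries.

(** * Measure of the parameters where two points are close *)

Section Measure.
Variable R : realType.
Local Notation mu := (@lebesgue_measure R).

(** Cut [0, 1) into K + 1 equal cells: the part of A in a cell lies within rho of any one of its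
    points, hence in an interval of length 2 rho. *)
Lemma measure_le_of_local_diameter (A : set R) (K : nat) (rho : R) :
  measurable A -> A `<=` `[0, 1[ -> 0 <= rho ->
  (forall x y, A x -> A y -> `|x - y| <= K.+1%:R^-1 -> `|x - y| <= rho) ->
  (mu A <= (K.+1%:R * (2 * rho))%:E)%E.
Proof.
move=> mA A01 rho0 diam; have K0 : 0 < K.+1%:R :> R by [].
have /choice[f fP] (i : nat) : exists c : R,
    forall x, A x -> Num.truncn (x * K.+1%:R) = i -> x \in `[c - rho, c + rho].
  have [[c [Ac ci]]|nex] :=
      pselect (exists c, A c /\ Num.truncn (c * K.+1%:R) = i); last first.
    (* A cell that misses A may take any centre. *)
    by exists 0 => x Ax xi; case: nex; exists x.
  exists c => x Ax xi; rewrite in_itv /=.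
  suff : `|x - c| <= rho by rewrite ler_norml; lra.
  apply: diam => //; rewrite -[leRHS]mul1r ler_pdivlMr //.
  have x0 : 0 <= x * K.+1%:R.
    by have := A01 _ Ax; rewrite /= in_itv => /andP[? _]; rewrite mulr_ge0.
  have c0 : 0 <= c * K.+1%:R.
    by have := A01 _ Ac; rewrite /= in_itv => /andP[? _]; rewrite mulr_ge0.
  rewrite -[X in _ * X](gtr0_norm K0) -normrM mulrBl ler_norml.
  have := truncn_itv x0; have := truncn_itv c0; rewrite xi ci -[i.+1%:R]natr1.
  lra.
pose J (i : nat) := [set` `[f i - rho, f i + rho]].
have cov : A `<=` \big[setU/set0]_(i < K.+1) J i.
  move=> x Ax; have := A01 _ Ax; rewrite /= in_itv /= => /andP[x0 x1].
  have tK : (Num.truncn (x * K.+1%:R) < K.+1)%N.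
    have xK : 0 <= x * K.+1%:R by rewrite mulr_ge0.
  have /andP[le_x _] := truncn_itv xK.
  rewrite -(ltr_nat R); apply: le_lt_trans le_x _.
  by rewrite -[ltRHS]mul1r ltr_pM2r.
  rewrite -bigcup_mkord; exists (Num.truncn (x * K.+1%:R)) => //.
  exact: fP.
have mJ (i : nat) : measurable (J i) by exact: measurable_itv.
apply: (le_trans (@content_subadditive _ _ _ mu A J K.+1 _ mA cov)).
  by move=> i _; exact: mJ.
rewrite (eq_bigr (fun=> (2 * rho)%:E)).
  by rewrite sumEFin big_const_ord iter_addr_0 [K.+1%:R * _]mulr_natl.
move=> i _; apply: etrans (lebesgue_measure_itv _) _; rewrite /= lte_fin.
have [lt|le] := ltP; first by rewrite -EFinD; congr EFin; ring.
have rho_eq0 : rho = 0 by lra.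
by rewrite rho_eq0 mulr0.
Qed.

Lemma continuous_ev (h : seq R) : continuous (ev h : R -> R).
Proof.
elim: h => [|b h IH] x /=; first exact: cst_continuous.
by apply: cvgD; [exact: cvg_cst|apply: cvgM; [exact: cvg_id|exact: IH]].
Qed.

Definition word_diff (N : nat) (w t : Omega N) : seq R :=
  [seq (w i)%:R - (t i)%:R | i <- enum 'I_N].

Lemma digits_word_diff N (w t : Omega N) : digits (word_diff w t).
Proof.
apply/allP => _ /mapP[i _ ->]; rewrite !inE.
by case: (w i); case: (t i); rewrite ?subrr ?subr0 ?sub0r eqxx ?orbT.
Qed.

Lemma nth_word_diff N (w t : Omega N) (i : 'I_N) :
  (word_diff w t)`_i = (w i)%:R - (t i)%:R.
Proof. by rewrite (nth_map i) ?size_enum_ord // nth_ord_enum. Qed.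

Lemma bernoulli_pointB N (w t : Omega N) x :
  bernoulli_point x w - bernoulli_point x t = (1 - x) * ev (word_diff w t) x.
Proof.
rewrite /bernoulli_point -mulrBr -sumrB ev_sum size_map size_enum_ord.
by congr (_ * _); apply: eq_bigr => i _; rewrite nth_word_diff mulrBl.
Qed.

Definition close_set N (w t : Omega N) (eps : R) : set R :=
  [set x | `|bernoulli_point x w - bernoulli_point x t| <= eps].

Lemma measurable_close_set N (w t : Omega N) eps :
  measurable (close_set w t eps).
Proof.
apply: closed_measurable.
rewrite [X in closed X](_ : _ =
    (fun x => `|(1 - x) * ev (word_diff w t) x|) @^-1` [set y | y <= eps]).
  apply: preimage_closed; last exact: closed_le.
  move=> x _; apply: cvg_norm.
  apply: cvgM; last exact: continuous_ev.
  by apply: cvgB; [exact: cvg_cst|exact: cvg_id].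
by apply/seteqP; split=> x; rewrite /close_set /= bernoulli_pointB.
Qed.

Definition agree N (k : nat) (w t : Omega N) : bool :=
  [forall i : 'I_N, (i < k)%N ==> (w i == t i)].

Lemma first_disagreement N (w t : Omega N) : w != t ->
  exists2 k : 'I_N, agree k w t & w k != t k.
Proof.
move=> wt; have [i0 wi0] : exists i, w i != t i.
  apply/existsP; apply: contraNT wt => /existsPn same.
  by apply/eqP/ffunP => i; apply/eqP; rewrite -[_ == _]negbK same.
case: (arg_minnP (P := fun i => w i != t i) (@nat_of_ord N) wi0) => k wk kmin.
exists k => //; apply/forallP => i; apply/implyP => ik.
by rewrite -[_ == _]negbK; apply: contraL ik => /kmin; rewrite -leqNgt.
Qed.

(** On [l0, l1] the factor (1 - x) x^k is at least (1 - l1) l0^k, so closeness becomes a sublevel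
    condition on a series with leading digit 1. *)
Lemma close_set_measure (l0 l1 : R) : 1 / 2 < l0 -> l1 < 668 / 1000 ->
  exists2 C : R, 0 < C & forall N (w t : Omega N) eps, 0 <= eps -> w != t ->
  exists2 k : 'I_N, agree k w t &
  (mu (close_set w t eps `&` `[l0, l1]) <= (C * eps * l0^-1 ^+ k)%:E)%E.
Proof.
move=> l0_gt l1_lt; have [delta d0 trans] := transversality R.
(* Makes the cell length 1 / (K + 1) at most delta / 56, the scale of [sublevel_diameter]. *)
pose K := Num.truncn (56 / delta).
have r0 : 0 < 1 - l1 by lra.
have l0_0 : 0 < l0 by lra.
have KP : K.+1%:R^-1 <= delta / 56.
  have n0 : 0 <= 56 / delta by rewrite divr_ge0 // ltW.
  rewrite -[delta / 56]invf_div lef_pV2 ?posrE ?divr_gt0 //.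
  by have /andP[_ /ltW] := truncn_itv n0.
exists (K.+1%:R * (2 * (4 / delta / (1 - l1)))).
  by rewrite !mulr_gt0 ?invr_gt0.
move=> N w t eps eps0 /first_disagreement[k agr wk]; exists k => //.
have diff_k : (word_diff w t)`_k != 0.
  by rewrite nth_word_diff; move: wk; case: (w k); case: (t k) => //=.
have diff_lt i : (i < k)%N -> (word_diff w t)`_i = 0.
  move=> ik; have iN := ltn_trans ik (ltn_ord k).
  have := nth_word_diff w t (Ordinal iN) => /= ->.
  have /forallP/(_ (Ordinal iN)) := agr; rewrite /= ik => /eqP->.
  by rewrite subrr.
have [h dh hE] := ev_first_nonzero (digits_word_diff w t) diff_k diff_lt.
pose rho := 4 / delta * (eps / (1 - l1) * l0^-1 ^+ k).
have -> : K.+1%:R * (2 * (4 / delta / (1 - l1))) * eps * l0^-1 ^+ k =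
    K.+1%:R * (2 * rho) by rewrite /rho; ring.
have small x : (close_set w t eps `&` `[l0, l1]) x ->
    `|ev (1 :: h) x| <= eps / (1 - l1) * l0^-1 ^+ k.
  move=> [/= cx]; rewrite in_itv /= => /andP[x0 x1]; move: cx.
  rewrite /close_set /= bernoulli_pointB normrM hE.
  rewrite exprVn ler_pdivlMr ?exprn_gt0 // ler_pdivlMr // => cx.
  apply: le_trans cx; rewrite mulrC; apply: ler_pM => //.
  - by rewrite ltW.
  - by rewrite mulr_ge0 // exprn_ge0 // ltW.
  - by rewrite ger0_norm; lra.
  rewrite mulrC; apply: ler_wpM2r => //.
  by rewrite lerXn2r // ?nnegrE ?normr_ge0 ?(ltW l0_0) // ger0_norm; lra.
apply: measure_le_of_local_diameter.
- by apply: measurableI; [exact: measurable_close_set|].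
- by move=> x [_]; rewrite /= !in_itv /=; lra.
- by rewrite !mulr_ge0 ?invr_ge0 ?exprn_ge0 ?invr_ge0 // ltW.
move=> x y Ax Ay xy.
have [_ xI] := Ax; have [_ yI] := Ay; move: xI yI.
rewrite /= !in_itv /= => xI yI.
apply: (sublevel_diameter trans d0 dh) => //; try lra.
- exact: le_trans xy KP.
- exact: small.
- exact: small.
Qed.

(** * Counting pairs by common prefix *)

(** The indicator is a product over positions, so its sum factors: one admissible letter at each
    position below k, two at the others. *)
Lemma sum_agree N (k : 'I_N) (w : Omega N) :
  \sum_(t : Omega N) (agree k w t)%:R = 2 ^+ (N - k) :> R.
Proof.
have agreeE (t : Omega N) : (agree k w t)%:R =
    \prod_(i : 'I_N) ((i < k)%N ==> (w i == t i))%:R :> R.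
  have [/forallP agr|/forallPn[i /negbTE dis]] := boolP (agree k w t).
    by rewrite big1 // => i _; rewrite agr.
  by rewrite (bigD1 i) //= dis mul0r.
rewrite (eq_bigr _ (fun t _ => agreeE t)).
rewrite -(bigA_distr_bigA (fun (i : 'I_N) b => ((i < k)%N ==> (w i == b))%:R)).
rewrite (eq_bigr (fun i : 'I_N => if (i < k)%N then 1 else 2 : R)); last first.
  move=> i _; rewrite big_bool; case: ltnP => _ /=; last by [].
  by case: (w i) => /=; rewrite ?addr0 ?add0r.
rewrite -(big_mkord xpredT (fun i => if (i < k)%N then 1 else 2 : R)).
rewrite (@big_cat_nat _ _ _ k) //=; last exact: ltnW.
rewrite big_nat big1 ?mul1r; last by move=> i /andP[_ ->].
rewrite big_nat (eq_bigr (fun=> 2)) -?big_nat ?prodr_const_nat //.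
by move=> i /andP[ki _]; rewrite ltnNge ki.
Qed.

Lemma geometric_sum_le (z : R) N : 0 <= z < 1 ->
  \sum_(k < N) z ^+ k <= (1 - z)^-1.
Proof.
move=> /andP[z0 z1]; have d0 : 0 < 1 - z by lra.
rewrite -[leRHS]mul1r ler_pdivlMr //.
have := subrX1 z N; have : 0 <= z ^+ N by rewrite exprn_ge0.
rewrite mulrC; lra.
Qed.

(** After exchanging the sums, each k contributes 4^N (2 l0)^-k, a geometric series since 2 l0 >
    1. *)
Lemma agree_sum_le (l0 : R) N : 1 / 2 < l0 ->
  \sum_(p : Omega N * Omega N) \sum_(k < N)
    (agree k p.1 p.2)%:R * l0^-1 ^+ k
    <= 2 ^+ N * 2 ^+ N * (1 - (2 * l0)^-1)^-1.
Proof.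
move=> l0_gt; have l0_0 : 0 < l0 by lra.
rewrite exchange_big /=.
rewrite (eq_bigr (fun k : 'I_N => 2 ^+ N * 2 ^+ N * (2 * l0)^-1 ^+ k)).
  rewrite -mulr_sumr ler_wpM2l ?mulr_ge0 ?exprn_ge0 //.
  apply: geometric_sum_le; rewrite invr_ge0 mulr_ge0 ?ltW //=.
  by rewrite invf_lt1; lra.
move=> k _; rewrite -mulr_suml -(pair_bigA _ (fun w t => (agree k w t)%:R)) /=.
rewrite (eq_bigr _ (fun w _ => sum_agree k w)).
rewrite sumr_const card_ffun card_bool card_ord.
rewrite -[X in X * _ = _]mulr_natl natrX.
have pow2 : 2 ^+ N = 2 ^+ (N - k) * 2 ^+ k :> R.
  by rewrite -exprD subnK // ltnW.
rewrite -!mulrA; congr (_ * _); rewrite pow2 invfM exprMn -mulrA.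
by congr (_ * _); rewrite mulrA -exprMn divff // expr1n mul1r.
Qed.

(** * Integral of the pair correlation *)

Lemma integral_pair_correlation (l0 l1 s : R) N :
  (\int[mu]_(lambda in `[l0, l1]) (pair_correlation s lambda N)%:E =
   ((2 ^+ N)^-1)%:E *
   \sum_(p : Omega N * Omega N | p.1 != p.2)
     mu (close_set p.1 p.2 (s / 2 ^+ N) `&` `[l0, l1]))%E.
Proof.
pose f (p : Omega N * Omega N) x : \bar R :=
  (\1_(close_set p.1 p.2 (s / 2 ^+ N)) x)%:E.
(* Filtering turns the conditional sum into a sum over a plain list, the form used for measurability
   and integration. *)
pose r := [seq p <- enum {: Omega N * Omega N} | p.1 != p.2].
have rE (F : Omega N * Omega N -> \bar R) :
    (\sum_(p | p.1 != p.2) F p = \sum_(p <- r) F p)%E.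
  by rewrite /r big_filter big_enum_cond; apply: eq_bigl => p; rewrite inE.
have pcE x : (pair_correlation s x N)%:E =
    (((2 ^+ N)^-1)%:E * \sum_(p <- r) f p x)%E.
  rewrite -rE /pair_correlation sumEFin -EFinM; congr (_ * _)%:E.
  rewrite -sum1_card natr_sum big_mkcondr /=; apply: eq_bigr => p _.
  rewrite indicE; case: ifPn => h; first by rewrite mem_set.
  by rewrite memNset //; apply/negP.
under eq_integral do rewrite pcE.
have mf p : measurable_fun `[l0, l1] (f p).
  by apply/measurable_EFinP; apply: measurable_indic;
    exact: measurable_close_set.
have f0 p x : (0 <= f p x)%E by rewrite lee_fin.
rewrite ge0_integralZl_EFin ?invr_ge0 ?exprn_ge0 //; last 2 first.
- by move=> x _; apply: sume_ge0.
- exact: emeasurable_sum.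
rewrite rE ge0_integral_sum //; congr (_ * _)%E; apply: eq_bigr => p _.
by rewrite integral_indic //; exact: measurable_close_set.
Qed.

End Measure.

Theorem theorem2p1 (R : realType) (lambda0 lambda1 : R)
    (hI : lambda0 <= lambda1)
    (h0 : 1 / 2 < lambda0) (h1 : lambda1 < 668 / 1000) :
  exists2 C1 : R, 0 < C1 &
    forall (N : nat) (s : R), (1 <= N)%N -> 0 < s ->
      (\int[lebesgue_measure]_(lambda in `[lambda0, lambda1])
         (pair_correlation s lambda N)%:E <= (C1 * s)%:E)%E.
Proof.
have [C C0 close] := close_set_measure h0 h1.
have l0 : 0 < lambda0 by lra.
have d0 : 0 < 1 - (2 * lambda0)^-1 by rewrite subr_gt0 invf_lt1; lra.
exists (C * (1 - (2 * lambda0)^-1)^-1) => [|N s _ s0].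
  by rewrite mulr_gt0 ?invr_gt0.
rewrite integral_pair_correlation.
have eps0 : 0 <= s / 2 ^+ N by rewrite divr_ge0 ?exprn_ge0 // ltW.
have le_sum : (\sum_(p : Omega N * Omega N | p.1 != p.2)
    lebesgue_measure (close_set p.1 p.2 (s / 2 ^+ N)
                        `&` [set` `[lambda0, lambda1]]) <=
  (C * (s / 2 ^+ N) * \sum_(p : Omega N * Omega N) \sum_(k < N)
    (agree k p.1 p.2)%:R * lambda0^-1 ^+ k)%:E)%E.
  rewrite mulr_sumr -sumEFin big_mkcond; apply: lee_sum => p _.
  have term_ge0 (k : 'I_N) : 0 <= (agree k p.1 p.2)%:R * lambda0^-1 ^+ k.
    by rewrite mulr_ge0 // exprn_ge0 // invr_ge0 ltW.
  case: ifPn => [pq|_]; last first.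
    rewrite lee_fin mulr_ge0 ?sumr_ge0 // mulr_ge0 //; exact: ltW.
  have [k agr le_k] := close N p.1 p.2 _ eps0 pq.
  apply: le_trans le_k _; rewrite lee_fin; apply: ler_wpM2l.
    by rewrite mulr_ge0 // ltW.
  (* The bound for this pair is the term at k of a sum of nonnegative terms. *)
  rewrite (bigD1 k) //= agr mul1r lerDl; exact: sumr_ge0.
apply: le_trans (lee_wpmul2l _ le_sum) _.
  by rewrite lee_fin invr_ge0 exprn_ge0.
rewrite -EFinM lee_fin.
have p0 : 0 < 2 ^+ N :> R by rewrite exprn_gt0.
have := agree_sum_le N h0; set S := \sum_(p : _) _; set Z := (1 - _)^-1 => SZ.
(* One factor 2^-N is the normalization, the other the scale s / 2^N; together they cancel the 4^N
   in the bound on S. *)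
have -> : (2 ^+ N)^-1 * (C * (s / 2 ^+ N) * S) =
    C * s * ((2 ^+ N)^-1 * (2 ^+ N)^-1) * S by ring.
have -> : C * Z * s =
    C * s * ((2 ^+ N)^-1 * (2 ^+ N)^-1) * (2 ^+ N * 2 ^+ N * Z).
  by field; rewrite gt_eqF.
by apply: ler_wpM2l => //; rewrite !mulr_ge0 ?invr_ge0 // ltW.
Qed.
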